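(* Let $R\subset\{x\in\mathbb{R}^n\mid x\ge\mathbf{0}\}$ be a non-empty up-monotone polyhedron with $V(R)\subset\{0,1\}^n$, let $P=R\cap[0,1]^n$, and let $\xi$ and $\eta$ be distinct vertices of $R$. Then $\xi$ and $\eta$ are adjacent in $P$ if and only if they are adjacent in $R$.
   Context: $V(S)$ denotes the set of vertices of a polyhedron $S$. Vector inequalities are component-wise. A polyhedron $R$ is up-monotone if $x\in R$ and $y\ge x$ imply $y\in R$. Two distinct vertices $\xi,\eta$ of a polyhedron $S\subset\mathbb{R}^n$ are adjacent in $S$ if there exist $c\in\mathbb{R}^n$ and $b\in\mathbb{R}$ such that $c\cdot x\ge b$ for all $x\in S$, with equality if and only if $x$ belongs to the closed segment $[\xi,\eta]$ (that is, $[\xi,\eta]$ is an edge of $S$). Every vertex of $R$ lying in $P$ is a vertex of $P$, so $\xi,\eta$ are vertices of $P$. *)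

(* Defs.v *)
From mathcomp Require Import all_boot all_order all_algebra.
From mathcomp Require Import classical_sets reals.

Set Implicit Arguments.
Unset Strict Implicit.
Unset Printing Implicit Defensive.

Import Order.TTheory GRing.Theory Num.Theory.

Local Open Scope classical_set_scope.
Local Open Scope ring_scope.

Definition dot (K : realType) (n : nat) (c x : 'cV[K]_n) : K :=
  \sum_(i < n) c i 0 * x i 0.

Definition le_vec (K : realType) (n : nat) (x y : 'cV[K]_n) : Prop :=
  forall i : 'I_n, x i 0 <= y i 0.

Definition is_polyhedron (K : realType) (n : nat) (S : set 'cV[K]_n) : Prop :=
  exists (m : nat) (A : 'M[K]_(m, n)) (b : 'cV[K]_m),
    S = [set x | le_vec b (A *m x)].

Definition up_monotone (K : realType) (n : nat) (S : set 'cV[K]_n) : Prop :=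
  forall x y : 'cV[K]_n, S x -> le_vec x y -> S y.

Definition segment (K : realType) (n : nat) (x y : 'cV[K]_n) : set 'cV[K]_n :=
  [set z | exists t : K, 0 <= t <= 1 /\ z = (1 - t) *: x + t *: y].

(* The equivalence is required only at points of S, since the hyperplane
   c . x = b may leave S; hence the separate condition F `<=` S. *)
Definition exposed_face (K : realType) (n : nat) (S F : set 'cV[K]_n) : Prop :=
  F `<=` S /\
  exists (c : 'cV[K]_n) (b : K),
    forall x : 'cV[K]_n, S x -> b <= dot c x /\ (dot c x = b <-> F x).

(* A vertex is a face of dimension 0. *)
Definition vertices (K : realType) (n : nat) (S : set 'cV[K]_n) :
    set 'cV[K]_n :=
  [set v | exposed_face S [set v]].

Definition adjacent (K : realType) (n : nat) (S : set 'cV[K]_n)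
    (xi eta : 'cV[K]_n) : Prop :=
  [/\ vertices S xi, vertices S eta, xi <> eta &
      exposed_face S (segment xi eta)].

Definition nonneg_orthant (K : realType) (n : nat) : set 'cV[K]_n :=
  [set x | le_vec 0 x].

Definition unit_cube (K : realType) (n : nat) : set 'cV[K]_n :=
  [set x | forall i : 'I_n, 0 <= x i 0 <= 1].

Definition binary_points (K : realType) (n : nat) : set 'cV[K]_n :=
  [set x | forall i : 'I_n, x i 0 = 0 \/ x i 0 = 1].

(* Main.v *)
(** The direction from [R] to [P] is a restriction. Conversely, let [c] expose
    the segment in [P]. Adding a unit vector to [xi] or [eta] shows that
    [c i > 0] unless [xi i = eta i = 1]. Let [c'] be the positive part of [c],
    increased by a small [e] at the coordinates where [xi] and [eta] are both
    [1]. Raising to [1] the coordinates of a binary point [v] of [R] at which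
    [c] is negative gives a point of [P], and comparing the two shows that [c']
    is minimal over the binary points of [R] exactly at [xi] and [eta]. Since
    [c' > 0] and every point of [R] dominates a convex combination of vertices,
    [c'] exposes the segment in [R]. *)
Require Import Defs.
From mathcomp Require Import all_boot all_order all_algebra.
From mathcomp Require Import boolp classical_sets reals.
From mathcomp Require Import ring lra.

Set Implicit Arguments.
Unset Strict Implicit.
Unset Printing Implicit Defensive.

Import Order.TTheory GRing.Theory Num.Theory.

Local Open Scope classical_set_scope.
Local Open Scope ring_scope.

(** * Linearity and monotonicity of the dot product *)

Section Dot.
Context {K : realType} {n : nat}.
Implicit Types (c x y : 'cV[K]_n) (t : K).

Lemma dotDr c x y : dot c (x + y) = dot c x + dot c y.
Proof. by rewrite -big_split; apply: eq_bigr => i _; rewrite mxE mulrDr. Qed.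

Lemma dotZr c t x : dot c (t *: x) = t * dot c x.
Proof. by rewrite [RHS]mulr_sumr; apply: eq_bigr => i _; rewrite mxE mulrCA. Qed.

Lemma dotBr c x y : dot c (x - y) = dot c x - dot c y.
Proof. by rewrite -scaleN1r dotDr dotZr mulN1r. Qed.

Lemma dot_delta c i : dot c (delta_mx i 0) = c i 0.
Proof.
rewrite /dot (bigD1 i) //= big1 => [|j ji]; first by rewrite mxE !eqxx mulr1 addr0.
by rewrite mxE (negPf ji) mulr0.
Qed.

Lemma dot_le c x y : le_vec 0 c -> le_vec x y -> dot c x <= dot c y.
Proof.
move=> c0 xy; apply: ler_sum => i _; apply: ler_wpM2l (xy i).
by have := c0 i; rewrite mxE.
Qed.

Lemma dot_le_eq c x y : (forall i, 0 < c i 0) -> le_vec x y ->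
  dot c x = dot c y -> x = y.
Proof.
move=> c0 xy /eqP; rewrite eq_sym -subr_eq0 -dotBr psumr_eq0; last first.
  by move=> i _; rewrite mulr_ge0 ?(ltW (c0 i))// !mxE subr_ge0; exact: xy.
move=> /allP e; apply/colP => i.
have := e i (mem_index_enum i).
by rewrite /= mulf_eq0 gt_eqF //= !mxE subr_eq0 => /eqP.
Qed.

Lemma le_vec_anti x y : le_vec x y -> le_vec y x -> x = y.
Proof.
by move=> xy yx; apply/colP => i; apply/le_anti; rewrite xy yx.
Qed.

End Dot.

(** * Vertices and recession directions of a polyhedron *)

Section Polyhedron.
Context {K : realType} {m n : nat} {A : 'M[K]_(m, n)} {b : 'cV[K]_m}.
Implicit Types (x y d : 'cV[K]_n) (Q : set 'cV[K]_n).

Local Notation S := [set x : 'cV[K]_n | le_vec b (A *m x)].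

Definition slack x := [set j | (A *m x) j 0 != b j 0]%SET.

Lemma mulmx_line x d (t : K) j :
  (A *m (x + t *: d)) j 0 = (A *m x) j 0 + t * (A *m d) j 0.
Proof. by rewrite mulmxDr -scalemxAr !mxE. Qed.

(** The ratio test of the simplex method: tight constraints stay tight along [d], and the step
    length is the smallest at which a decreasing constraint becomes tight. *)
Lemma ratio_step x d j0 : S x ->
  (forall j, j \notin slack x -> (A *m d) j 0 = 0) -> (A *m d) j0 0 < 0 ->
  exists2 t : K, 0 < t & S (x + t *: d) /\ (#|slack (x + t *: d)| < #|slack x|)%N.
Proof.
move=> Sx dtight dj0.
pose F j := ((A *m x) j 0 - b j 0) / - (A *m d) j 0.
case: (@arg_minP _ _ _ j0 (fun j => (A *m d) j 0 < 0) F dj0) => j1 dj1 jmin.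
have slj j : (A *m d) j 0 < 0 -> j \in slack x.
  by move=> dj; apply: contraTT dj => /dtight ->; rewrite ltxx.
have Fj1 : 0 < F j1.
  rewrite divr_gt0 ?oppr_gt0 // subr_gt0 lt_neqAle Sx andbT eq_sym.
  by have := slj _ dj1; rewrite inE.
exists (F j1) => //; split => [j|].
  rewrite mulmx_line; have [dj|dj] := ltP ((A *m d) j 0) 0; last first.
    by apply: le_trans (Sx j) _; rewrite lerDl mulr_ge0 // ltW.
  have := jmin _ dj; rewrite [leRHS]/F ler_pdivlMr ?oppr_gt0 //; lra.
apply: proper_card; apply/properP; split.
  apply/fintype.subsetP => j; apply: contraLR => jx.
  by rewrite inE negbK mulmx_line (dtight _ jx) mulr0 addr0; move: jx; rewrite inE negbK.
exists j1; first exact: slj.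
rewrite inE negbK mulmx_line /F; apply/eqP; field.
by rewrite lt_eqF.
Qed.

(** If [d i < 0], the step of length [t] from [x] stays in [S] but brings coordinate [i] to [-1]. *)
Lemma recession_ge0 x d : S `<=` @nonneg_orthant K n -> S x ->
  le_vec 0 (A *m d) -> le_vec 0 d.
Proof.
move=> S0 Sx Ad i; rewrite mxE leNgt; apply/negP => di.
have xi0 : 0 <= x i 0 by have := S0 _ Sx i; rewrite mxE.
pose t := (x i 0 + 1) / - d i 0.
have t0 : 0 <= t by rewrite divr_ge0 ?oppr_ge0 ?(ltW di)// addr_ge0.
have /S0 /(_ i) : S (x + t *: d).
  move=> j; rewrite mulmx_line; apply: le_trans (Sx j) _.
  by rewrite lerDl mulr_ge0 //; have := Ad j; rewrite mxE.
rewrite !mxE; have -> : t * d i 0 = - (x i 0 + 1) by rewrite /t; field; rewrite lt_eqF.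
lra.
Qed.

(** The sum of the tight rows exposes [x]: a point of [S] attaining its minimum is tight in each of
    these rows, so its difference from [x] is killed by all of them. *)
Lemma tight_vertex x : S x ->
  (forall d, (forall j, j \notin slack x -> (A *m d) j 0 = 0) -> d = 0) ->
  vertices S x.
Proof.
move=> Sx triv; split=> [_ -> //|].
pose c : 'cV[K]_n := \col_k \sum_(j | j \notin slack x) A j k.
have cE y : dot c y = \sum_(j | j \notin slack x) (A *m y) j 0.
  transitivity (\sum_k \sum_(j | j \notin slack x) A j k * y k 0).
    by apply: eq_bigr => k _; rewrite mxE mulr_suml.
  by rewrite exchange_big; apply: eq_bigr => j _; rewrite mxE.
have cx : dot c x = \sum_(j | j \notin slack x) b j 0.
  by rewrite cE; apply: eq_bigr => j; rewrite inE negbK => /eqP.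
exists c, (dot c x) => y Sy; split.
  by rewrite cx cE; apply: ler_sum => j _; exact: Sy.
split=> [/eqP|-> //]; rewrite -subr_eq0 cE cx -sumrB psumr_eq0; last first.
  by move=> j _; rewrite subr_ge0; exact: Sy.
move=> /allP e; apply/eqP; rewrite -subr_eq0; apply/eqP/triv => j jx.
have := e j (mem_index_enum j); rewrite jx /= subr_eq0 => /eqP.
move: jx; rewrite inE negbK => /eqP.
by rewrite mulmxBr !mxE => -> ->; rewrite subrr.
Qed.

(* As [S] contains no line, a non-vertex can be moved along a direction
   preserving the tight constraints until a new one becomes tight: either both
   ways, and it is a convex combination, or one way only, and the unbounded
   direction is nonnegative. *)
Lemma polyhedron_vertex_ind Q : S `<=` @nonneg_orthant K n ->
  vertices S `<=` Q ->
  (forall x y, Q x -> le_vec x y -> Q y) ->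
  (forall x y, Q x -> Q y -> segment x y `<=` Q) ->
  S `<=` Q.
Proof.
move=> S0 Qv Qup Qconv x; have [k] := ubnP #|slack x|.
elim: k x => // k IH x; rewrite ltnS => xk Sx.
have [[d [dtight d0]]|nd] := pselect (exists d,
    (forall j, j \notin slack x -> (A *m d) j 0 = 0) /\ d <> 0); last first.
  apply/Qv/tight_vertex => // d dtight.
  by have [//|d0] := pselect (d = 0); case: nd; exists d.
have step e : (forall j, j \notin slack x -> (A *m e) j 0 = 0) ->
    ~ le_vec 0 (A *m e) -> exists2 t : K, 0 < t & Q (x + t *: e).
  move=> et /existsNP[j]; rewrite mxE => /negP; rewrite -ltNge => ej.
  have [t t0 [Sy yk]] := ratio_step Sx et ej.
  by exists t => //; apply: IH => //; exact: leq_trans yk xk.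
have Ntight j : j \notin slack x -> (A *m - d) j 0 = 0.
  by move=> /dtight dj; rewrite mulmxN mxE dj oppr0.
(* The recession direction [e] is nonnegative, and [- e] cannot be one too since [e] is nonzero. The
   step along [- e] thus reaches a point of [Q] below [x]. *)
have down e : (forall j, j \notin slack x -> (A *m - e) j 0 = 0) -> e <> 0 ->
    le_vec 0 (A *m e) -> Q x.
  move=> et e0 Ae; have ege0 := recession_ge0 S0 Sx Ae.
  have [|t t0 Qy] := step (- e) et.
    move=> ANe; apply: e0; apply: le_vec_anti => // i.
    by have := recession_ge0 S0 Sx ANe i; rewrite !mxE oppr_ge0.
  apply: Qup Qy _ => i; have := ege0 i; rewrite !mxE => ei.
  by rewrite mulrN gerBl mulr_ge0 // ltW.
have [Ad|/(step d dtight)[t t0 Qy]] := pselect (le_vec 0 (A *m d)).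
  exact: down Ntight d0 Ad.
have [Ad|/(step (- d) Ntight)[s s0 Qz]] := pselect (le_vec 0 (A *m - d)).
  apply: down _ _ Ad; first by rewrite opprK.
  by move=> /eqP; rewrite oppr_eq0 => /eqP.
apply: (Qconv _ _ Qy Qz); exists (t / (t + s)); split.
  have ts : 0 < t + s by lra.
  rewrite divr_ge0 ?(ltW t0) ?(ltW ts) //= ler_pdivrMr //; lra.
apply/colP => i; rewrite !mxE; field.
by apply/eqP; lra.
Qed.

End Polyhedron.

(** * Vertices and segments in up-monotone sets *)

Section UpMonotone.
Context {K : realType} {n : nat}.
Implicit Types (R F S : set 'cV[K]_n) (v x y : 'cV[K]_n).

Lemma polyhedron_segment R x y : is_polyhedron R -> R x -> R y ->
  segment x y `<=` R.
Proof.
move=> [m [A [b ->]]] Rx Ry _ [t [/andP[t0 t1] ->]] j.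
rewrite mulmxDr -!scalemxAr !mxE.
have := Rx j; have := Ry j; rewrite !mxE => yj xj.
have -> : b j 0 = (1 - t) * b j 0 + t * b j 0 by ring.
by rewrite lerD // ler_wpM2l // subr_ge0.
Qed.

Lemma exposed_face_sub R S F : S `<=` R -> F `<=` S ->
  exposed_face R F -> exposed_face S F.
Proof.
by move=> SR FS [_ [c [b cb]]]; split=> //; exists c, b => x /SR; exact: cb.
Qed.

(** The reflection [v + (v - y)] lies above [v], hence in [R]. So [v] is the midpoint of two points
    of [R], and exposedness makes them equal to [v]. *)
Lemma up_vertex_min R v y : up_monotone R -> vertices R v -> R y ->
  le_vec y v -> y = v.
Proof.
move=> Rup [vR [c [b cb]]] Ry yv.
have Rv : R v by exact: vR.
have R2 : R (v + (v - y)).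
  by apply: Rup Rv _ => i; rewrite !mxE lerDl subr_ge0; exact: yv.
have [_ [_ cv]] := cb _ Rv; have [cy [cyv _]] := cb _ Ry.
have [c2 _] := cb _ R2.
apply: cyv; move: c2 (cv erefl); rewrite dotDr dotBr; lra.
Qed.

Lemma binary_unit_cube x : @binary_points K n x -> @unit_cube K n x.
Proof. by move=> xb i; case: (xb i) => ->; rewrite ?lexx ?ler01. Qed.

Lemma segment_sym x y : segment x y `<=` segment y x.
Proof.
move=> _ [t [t01 ->]]; exists (1 - t); split; first lra.
by rewrite opprB addrCA subrr addr0 addrC.
Qed.

Lemma segment_convex x y v w : segment x y v -> segment x y w ->
  segment v w `<=` segment x y.
Proof.
move=> [s [/andP[s0 s1] ->]] [t [/andP[t0 t1] ->]] _ [u [/andP[u0 u1] ->]].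
exists ((1 - u) * s + u * t); split; last by apply/colP => i; rewrite !mxE; ring.
by apply/andP; split; nra.
Qed.

(** Raising coordinate [i] of [xi] to [1] stays in the cube, so [c i >= 0]. If [c i = 0], the raised
    point is on the segment, which forces [xi <= eta], against the minimality of the vertex
    [eta]. *)
Lemma exposed_coord_gt0 R (xi eta c : 'cV[K]_n) b i : up_monotone R ->
  binary_points xi -> vertices R xi -> vertices R eta -> xi <> eta ->
  (forall x, (R `&` @unit_cube K n) x ->
     b <= dot c x /\ (dot c x = b <-> segment xi eta x)) ->
  xi i 0 = 0 -> 0 < c i 0.
Proof.
move=> Rup xib xiv etav ne cb xi0.
have Rxi : R xi by case: xiv => + _; exact.
have Pxi : (R `&` @unit_cube K n) xi by split=> //; exact: binary_unit_cube.
have le_e : le_vec xi (xi + delta_mx i 0).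
  by move=> j; rewrite !mxE lerDl ler0n.
have Pe : (R `&` @unit_cube K n) (xi + delta_mx i 0).
  split; first exact: Rup Rxi le_e.
  move=> j; rewrite !mxE eqxx andbT; have [->|_] := eqVneq j i.
    by rewrite xi0 add0r ler01 lexx.
  by rewrite addr0; exact: binary_unit_cube.
have cxi : dot c xi = b.
  by apply (cb _ Pxi).2; exists 0; rewrite lexx ler01 subr0 scale1r scale0r addr0.
have [ce ceq] := cb _ Pe; rewrite lt_neqAle andbC.
have ci : 0 <= c i 0 by move: ce; rewrite dotDr dot_delta cxi; lra.
rewrite ci /= eq_sym; apply/eqP => ci0.
have [|t [/andP[t0 _] te]] := ceq.1 _; first by rewrite dotDr dot_delta cxi ci0 addr0.
have tpos : 0 < t.
  rewrite lt_neqAle t0 andbT eq_sym; apply/eqP => t00.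
  move/colP/(_ i) : te; rewrite t00 !mxE !eqxx xi0 /=; lra.
apply: ne; apply: up_vertex_min Rup etav Rxi _ => j.
move/colP/(_ j) : te (le_e j); rewrite !mxE => -> h.
have : 0 <= t * (eta j 0 - xi j 0) by lra.
by rewrite pmulr_rge0 // subr_ge0.
Qed.

(** For [t < 1], a coordinate that is [0] in [xi] is below [1] in [w], hence [0] in [v]; so
    [v <= xi], and vertices are minimal. For [t = 1], [w] is [eta]. *)
Lemma binary_below_segment R (xi eta v w : 'cV[K]_n) : up_monotone R ->
  vertices R xi -> vertices R eta ->
  binary_points xi -> binary_points eta -> binary_points v ->
  R v -> le_vec v w -> segment xi eta w -> v = xi \/ v = eta.
Proof.
move=> Rup xiv etav xib etab vb Rv vw [t [/andP[t0 t1] we]].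
have [t_lt1|t_ge1] := ltP t 1; [left|right]; apply: up_vertex_min Rup _ Rv _ => // i;
  move: (vw i); rewrite we !mxE.
  case: (vb i) => ->; case: (xib i) => ->; case: (etab i) => ->; lra.
have -> : t = 1 by lra.
lra.
Qed.

End UpMonotone.

(** * Construction of a strictly positive functional *)

Lemma finite_positive_gap (K : realType) (T : finType) (g : T -> K) :
  exists2 e : K, 0 < e & forall a, 0 < g a -> e <= g a.
Proof.
(* The default [1] keeps the minimum positive even when [g] is nowhere positive. *)
exists (\big[Order.min/1]_(a | 0 < g a) g a).
  by apply: lt_bigmin.
by move=> a ga; exact: bigmin_le_cond.
Qed.

(** Indexing by subsets makes the binary points a finite family, as the gap argument requires. *)
Lemma binary_point_set (K : realType) n (v : 'cV[K]_n) : binary_points v ->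
  exists B : {set 'I_n}, v = \col_i (i \in B)%:R.
Proof.
move=> vb; exists [set i | v i 0 == 1]%SET; apply/colP => i; rewrite !mxE inE.
by case: (vb i) => ->; rewrite ?eqxx // eq_sym oner_eq0.
Qed.

Lemma adjacent_cube_functional (K : realType) n (R : set 'cV[K]_n)
    (xi eta c : 'cV[K]_n) (b : K) : up_monotone R ->
  binary_points xi -> binary_points eta ->
  vertices R xi -> vertices R eta -> xi <> eta ->
  (forall x, (R `&` @unit_cube K n) x ->
     b <= dot c x /\ (dot c x = b <-> segment xi eta x)) ->
  exists c' : 'cV[K]_n, [/\ forall i, 0 < c' i 0, dot c' eta = dot c' xi &
    forall v, R v -> binary_points v ->
      v = xi \/ v = eta \/ dot c' xi < dot c' v].
Proof.
move=> Rup xib etab xiv etav ne cb.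
have Rxi : R xi by case: xiv => + _; exact.
have Reta : R eta by case: etav => + _; exact.
have cxi : dot c xi = b.
  apply (cb xi (conj Rxi (binary_unit_cube xib))).2.
  by exists 0; rewrite lexx ler01 subr0 scale1r scale0r addr0.
have ceta : dot c eta = b.
  apply (cb eta (conj Reta (binary_unit_cube etab))).2.
  by exists 1; rewrite lexx ler01 subrr scale1r scale0r add0r.
have both1 i : c i 0 <= 0 -> xi i 0 = 1 /\ eta i 0 = 1.
  rewrite leNgt => /negP ci; split.
    case: (xib i) => // xi0; case: ci.
    exact: exposed_coord_gt0 Rup xib xiv etav ne cb xi0.
  case: (etab i) => // eta0; case: ci.
  apply: (exposed_coord_gt0 (xi := eta) (eta := xi) (b := b) Rup) eta0 => //.
    exact: nesym ne.
  move=> x Px; have [bx xE] := cb x Px; split=> //.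
  split=> [/(proj1 xE)/segment_sym //|/segment_sym].
  exact: (proj2 xE).
pose cp : 'cV[K]_n := \col_i Order.max (c i 0) 0.
(* The indicator of the common ones of [xi] and [eta]. By [both1] it is [1] wherever [cp] vanishes,
   so adding a positive multiple of it makes [cp] positive. *)
pose r : 'cV[K]_n := \col_i (xi i 0 * eta i 0).
have cpeta : dot cp eta = dot cp xi.
  apply/eqP; rewrite -subr_eq0 -dotBr.
  have -> : dot cp (eta - xi) = dot c (eta - xi); last by rewrite dotBr cxi ceta subrr.
  apply: eq_bigr => i _; rewrite !mxE; have [ci|//] := leP (c i 0) 0.
  by have [-> ->] := both1 i ci; rewrite subrr !mulr0.
have cpv v : R v -> binary_points v -> v <> xi -> v <> eta -> dot cp xi < dot cp v.
  move=> Rv vb vxi veta.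
  pose w : 'cV[K]_n := \col_i (if c i 0 <= 0 then 1 else v i 0).
  have vw : le_vec v w.
    move=> i; rewrite mxE; case: ifP => // _.
    by case: (vb i) => ->; rewrite ?ler01.
  have Pw : (R `&` @unit_cube K n) w.
    split; first exact: Rup Rv vw.
    move=> i; rewrite mxE; case: ifP => _; first by rewrite ler01 lexx.
    exact: binary_unit_cube.
  (* At a raised coordinate, [cp] is [0] on the left, while [w] and [xi] are both [1] on the right;
     elsewhere [cp] is [c] and [w] is [v]. *)
  have cw : dot cp v - dot cp xi = dot c w - b.
    rewrite -cxi -!dotBr; apply: eq_bigr => i _; rewrite !mxE.
    have [ci|//] := leP (c i 0) 0.
    by have [-> _] := both1 i ci; rewrite subrr mul0r mulr0.
  have [bw wE] := cb w Pw.
  rewrite lt_neqAle; apply/andP; split; last lra.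
  apply/eqP => e; have /wE seg : dot c w = b by lra.
  by have [] := binary_below_segment Rup xiv etav xib etab vb Rv vw seg.
have [e e0 egap] := finite_positive_gap
  (fun B : {set 'I_n} => dot cp (\col_i (i \in B)%:R) - dot cp xi).
(* As [dot r xi <= n], dividing by [n + 1] keeps the perturbation at [xi] strictly below the gap
   [e]. *)
pose h := e / n.+1%:R.
have h0 : 0 < h by rewrite divr_gt0 ?ltr0Sn.
have c'E x : dot (cp + h *: r) x = dot cp x + h * dot r x.
  rewrite /dot mulr_sumr -big_split; apply: eq_bigr => i _.
  by rewrite mxE [X in _ + X]mxE mulrDl mulrA.
exists (cp + h *: r); split.
- move=> i; rewrite !mxE; have [ci|ci] := leP (c i 0) 0.
    by have [-> ->] := both1 i ci; rewrite add0r !mulr1.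
  apply: ltr_wpDr ci; apply: mulr_ge0; first exact: ltW.
  by case: (xib i) => ->; case: (etab i) => ->; rewrite ?mulr0 ?mul0r ?mulr1 ?ler01.
- rewrite !c'E cpeta; congr (_ + _ * _); apply: eq_bigr => i _; rewrite !mxE.
  by case: (xib i) => ->; case: (etab i) => ->; rewrite ?mulr0 ?mul0r.
move=> v Rv vb.
have [->|vxi] := pselect (v = xi); first by left.
have [->|veta] := pselect (v = eta); first by right; left.
right; right; rewrite !c'E.
have gap : e <= dot cp v - dot cp xi.
  have [B vB] := binary_point_set vb.
  have := egap B; rewrite -vB; apply.
  by rewrite subr_gt0; exact: cpv.
have rxi : dot r xi <= n%:R.
  rewrite -[leRHS]mulr1 mulr_natl -{2}(card_ord n) -sumr_const.
  apply: ler_sum => i _; rewrite !mxE.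
  by case: (xib i) => ->; case: (etab i) => ->; rewrite ?mulr0 ?mul0r ?mulr1 ?ler01.
have rv : 0 <= dot r v.
  apply: sumr_ge0 => i _; rewrite !mxE.
  by case: (xib i) => ->; case: (etab i) => ->; case: (vb i) => ->;
     rewrite ?mulr0 ?mul0r ?mulr1 ?ler01.
have he : h * n%:R < e.
  by rewrite /h mulrAC ltr_pdivrMr ?ltr0Sn // ltr_pM2l // ltr_nat.
have h1 : h * dot r xi <= h * n%:R by rewrite ler_pM2l.
have h2 : 0 <= h * dot r v by rewrite mulr_ge0 // ltW.
lra.
Qed.

(** * Transfer of adjacency between the polyhedron and its part in the cube *)

Theorem theorem3p7 (K : realType) (n : nat) (R : set 'cV[K]_n)
    (R_polyhedron : is_polyhedron R)
    (R_nonneg : R `<=` @nonneg_orthant K n)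
    (R_nonempty : R !=set0)
    (R_up : up_monotone R)
    (R_vertices : vertices R `<=` @binary_points K n)
    (xi eta : 'cV[K]_n)
    (xi_vertex : vertices R xi)
    (eta_vertex : vertices R eta)
    (xi_neq_eta : xi <> eta) :
  let P := R `&` @unit_cube K n in
  adjacent P xi eta <-> adjacent R xi eta.
Proof.
have xib := R_vertices _ xi_vertex; have etab := R_vertices _ eta_vertex.
have Rxi : R xi by case: xi_vertex => + _; exact.
have Reta : R eta by case: eta_vertex => + _; exact.
have segR : segment xi eta `<=` R by exact: polyhedron_segment.
move=> P; have PR : P `<=` R by move=> x [].
have Pxi : P xi by split=> //; exact: binary_unit_cube.
have Peta : P eta by split=> //; exact: binary_unit_cube.
split=> [[_ _ _ [_ [c [b cb]]]]|[_ _ _ Rface]]; last first.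
  split=> //; [..|apply: exposed_face_sub PR _ Rface => x xseg].
  - by apply: exposed_face_sub PR _ xi_vertex => _ ->.
  - by apply: exposed_face_sub PR _ eta_vertex => _ ->.
  split; first exact: segR.
  case: xseg => t [/andP[t0 t1] ->] i; rewrite !mxE.
  by case: (xib i) => ->; case: (etab i) => ->; apply/andP; split; lra.
have [c' [c'0 c'eta c'v]] :=
  adjacent_cube_functional R_up xib etab xi_vertex eta_vertex xi_neq_eta cb.
split=> //; split=> //; exists c', (dot c' xi).
(* A property that passes to larger points and to convex combinations, so it need only be checked at
   the vertices. The converse implication is left out since [c'] is constant on the segment. *)
pose Q := [set x | dot c' xi <= dot c' x /\ (dot c' x = dot c' xi -> segment xi eta x)].
have seg_xi : segment xi eta xi.
  by exists 0; rewrite lexx ler01 subr0 scale1r scale0r addr0.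
have seg_eta : segment xi eta eta.
  by exists 1; rewrite lexx ler01 subrr scale1r scale0r add0r.
suff RQ : R `<=` Q.
  move=> x /RQ[le_x eq_x]; split=> //; split=> // -[t [_ ->]].
  by rewrite dotDr !dotZr c'eta; ring.
have [m [A [b' RE]]] := R_polyhedron.
rewrite {1}RE; apply: polyhedron_vertex_ind; rewrite -?RE //.
- move=> v vv; have Rv : R v by case: vv => + _; exact.
  have [->|[->|lt_v]] := c'v v Rv (R_vertices _ vv); rewrite /Q /= ?c'eta //.
  by split=> [|e]; [exact: ltW|rewrite e ltxx in lt_v].
- move=> x y [le_x eq_x] xy.
  have le_xy : dot c' x <= dot c' y.
    by apply: dot_le xy => i; rewrite mxE ltW.
  split=> [|e]; first exact: le_trans le_x le_xy.
  have cxy : dot c' x = dot c' y by lra.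
  by rewrite -(dot_le_eq c'0 xy cxy); apply: eq_x; rewrite cxy.
- move=> x y [le_x eq_x] [le_y eq_y] z [t [/andP[t0 t1] ->]].
  rewrite /Q /= dotDr !dotZr.
  split=> [|e]; first nra.
  (* With both weights positive, a minimal value at the combination forces minimal values at [x] and
     at [y]; at [t = 0] or [t = 1] only one of them is controlled. *)
  have [t00|tn0] := eqVneq t 0.
    rewrite t00 subr0 scale1r scale0r addr0; apply: eq_x.
    by rewrite t00 in e; lra.
  have [t11|tn1] := eqVneq t 1.
    rewrite t11 subrr scale1r scale0r add0r; apply: eq_y.
    by rewrite t11 in e; lra.
  have tp : 0 < t by rewrite lt_neqAle eq_sym tn0.
  have tq : 0 < 1 - t by rewrite subr_gt0 lt_neqAle tn1.
  have p1 : 0 <= (1 - t) * (dot c' x - dot c' xi) by rewrite mulr_ge0 ?subr_ge0.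
  have p2 : 0 <= t * (dot c' y - dot c' xi) by rewrite mulr_ge0 ?subr_ge0.
  have z1 : (1 - t) * (dot c' x - dot c' xi) = 0 by lra.
  have z2 : t * (dot c' y - dot c' xi) = 0 by lra.
  apply: (segment_convex (v := x) (w := y)); last by exists t; rewrite t0 t1.
    apply: eq_x; apply/eqP; rewrite -subr_eq0.
    by move/eqP: z1; rewrite mulf_eq0 (gt_eqF tq).
  apply: eq_y; apply/eqP; rewrite -subr_eq0.
  by move/eqP: z2; rewrite mulf_eq0 (gt_eqF tp).
Qed.
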